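(* Let $\Lambda$ be a finite dimensional algebra over a field, let $f:A\to B$ be an injective homomorphism of right $\Lambda$-modules and let $n$ be a nonnegative integer. If $\operatorname{dell}B\le n$, then $\operatorname{edell}A\le n$.
   Context: Modules are right $\Lambda$-modules; $\mathrm{mod}\,\Lambda$ denotes the finitely generated ones. $\mathbb N$ is the set of nonnegative integers; the infimum of the empty set is $+\infty$. $\Omega M$ is the kernel of a projective cover of $M$, $\Omega^0M=M$, $\Omega^{n+1}M=\Omega(\Omega^nM)$. ''$U$ is a direct summand of $V$ up to projective summands'' means that $U$ is isomorphic to a direct summand of $V\oplus P$ for some projective $P$. $\operatorname{dell}M$ is the infimum of all $n\in\mathbb N$ such that $\Omega^nM$ is a direct summand of $\Omega^{n+1}N$ up to projective summands for some $N\in\mathrm{mod}\,\Lambda$. $\operatorname{edell}M$ is the infimum of all $n\in\mathbb N$ such that for every integer $k'\ge1$ and every right $\Lambda$-module $X$ of injective dimension $\mathrm{id}\,X=n+k'$ one has $\mathrm{Ext}_\Lambda^{n+k'}(M,X)=0$. *)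

(* Defs.v *)
From HB Require Import structures.
From mathcomp Require Import all_boot all_order all_algebra all_field.
From mathcomp Require Import boolp.

Set Implicit Arguments.
Unset Strict Implicit.
Unset Printing Implicit Defensive.

Import GRing.Theory.
Local Open Scope ring_scope.

(* Infimum of a set of natural numbers in N \cup {+oo}; None stands for +oo,  *)
(* which is the value on the empty set.                                       *)
Definition inf_nat (S : nat -> Prop) : option nat :=
  match pselect (exists n, `[< S n >]) with
  | left exS => Some (ex_minn exS)
  | right _ => None
  end.

Definition le_enat (x : option nat) (n : nat) : bool :=
  if x is Some m then (m <= n)%N else false.

Section Modules.
Variable R : pzRingType.
Implicit Types M N P I K L U V W X : lmodType R.

Definition surjective_lin M N (g : {linear M -> N}) : Prop :=
  forall y, exists x, g x = y.

Definition exact_lin L M N (f : {linear L -> M}) (g : {linear M -> N}) : Prop :=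
  forall x, g x = 0 <-> exists y, f y = x.

Definition isomorphic M N : Prop := exists g : {linear M -> N}, bijective g.

Definition finitely_generated M : Prop :=
  exists (n : nat) (s : 'I_n -> M),
    forall x, exists c : 'I_n -> R, x = \sum_(i < n) c i *: s i.

Definition projective_module P : Prop :=
  forall M N (g : {linear M -> N}) (h : {linear P -> N}),
    surjective_lin g -> exists k : {linear P -> M}, forall x, g (k x) = h x.

Definition injective_module I : Prop :=
  forall M N (i : {linear M -> N}) (h : {linear M -> I}),
    injective i -> exists k : {linear N -> I}, forall x, k (i x) = h x.

(* The kernel of p is superfluous: ker p + S = P forces S = P.                *)
Definition superfluous_kernel P M (p : {linear P -> M}) : Prop :=
  forall S : {pred P}, submod_closed S ->
    (forall x, exists u v, [/\ p u = 0, v \in S & x = u + v]) ->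
    forall x, x \in S.

Definition projective_cover P M (p : {linear P -> M}) : Prop :=
  [/\ projective_module P, surjective_lin p & superfluous_kernel p].

(* Syzygies are only determined up to isomorphism, hence relations:           *)
(* is_syzygy M K means K ~ Omega M, and is_Omega n M K means K ~ Omega^n M.   *)
Definition is_syzygy M K : Prop :=
  exists P (p : {linear P -> M}) (i : {linear K -> P}),
    [/\ projective_cover p, injective i & exact_lin i p].

Fixpoint is_Omega (n : nat) M K : Prop :=
  if n is m.+1 then exists L, is_Omega m M L /\ is_syzygy L K
  else isomorphic M K.

Definition direct_summand U V : Prop :=
  exists W, isomorphic (U * W)%type V.

Definition summand_up_to_projective U V : Prop :=
  exists P, projective_module P /\ direct_summand U (V * P)%type.

Record projective_resolution M := ProjectiveResolution {
  pr_obj : nat -> lmodType R;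
  pr_diff : forall i, {linear pr_obj i.+1 -> pr_obj i};
  pr_aug : {linear pr_obj 0 -> M};
  pr_projective : forall i, projective_module (pr_obj i);
  pr_aug_surj : surjective_lin pr_aug;
  pr_exact0 : exact_lin (pr_diff 0) pr_aug;
  pr_exactS : forall i, exact_lin (pr_diff i.+1) (pr_diff i)
}.

Record injective_resolution X := InjectiveResolution {
  ir_obj : nat -> lmodType R;
  ir_diff : forall i, {linear ir_obj i -> ir_obj i.+1};
  ir_coaug : {linear X -> ir_obj 0};
  ir_injective : forall i, injective_module (ir_obj i);
  ir_coaug_inj : injective ir_coaug;
  ir_exact0 : exact_lin ir_coaug (ir_diff 0);
  ir_exactS : forall i, exact_lin (ir_diff i) (ir_diff i.+1)
}.

Definition inj_dim X : option nat :=
  inf_nat (fun m => exists E : injective_resolution X,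
    forall i, (m < i)%N -> forall x : ir_obj E i, x = 0).

Definition Ext_cocycle M (Q : projective_resolution M) X (n : nat)
    (g : {linear pr_obj Q n -> X}) : Prop :=
  forall x, g (pr_diff Q n x) = 0.

Definition Ext_coboundary M (Q : projective_resolution M) X (n : nat) :
    {linear pr_obj Q n -> X} -> Prop :=
  match n with
  | 0 => fun g => forall x, g x = 0
  | m.+1 => fun g => exists h : {linear pr_obj Q m -> X},
                       forall x, g x = h (pr_diff Q m x)
  end.

(* Ext^n(M, X) = H^n(Hom(Q, X)) vanishes. Every M has a projective resolution *)
(* (by free modules) and the cohomology does not depend on it, so quantifying *)
(* over all resolutions Q is the same as fixing one.                          *)
Definition Ext_eq0 (n : nat) M X : Prop :=
  forall (Q : projective_resolution M) (g : {linear pr_obj Q n -> X}),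
    Ext_cocycle g -> Ext_coboundary g.

Definition dell M : option nat :=
  inf_nat (fun n => exists N U V,
    [/\ finitely_generated N, is_Omega n M U, is_Omega n.+1 N V
      & summand_up_to_projective U V]).

Definition edell M : option nat :=
  inf_nat (fun n => forall (k : nat) X, (1 <= k)%N ->
    inj_dim X = Some (n + k)%N -> Ext_eq0 (n + k) M X).

End Modules.

(* Main.v *)
Require Import Defs.
From HB Require Import structures.
From mathcomp Require Import all_boot all_order all_algebra all_field.
From mathcomp Require Import boolp.
Local Open Scope ring_scope.

Set Implicit Arguments.
Unset Strict Implicit.
Unset Printing Implicit Defensive.
Import GRing.Theory.

(* Let [E] be an injective resolution of [X] of length [d = m + k], [k >= 1].   *)
(* Since [E_(d+1) = 0], [Ext^d(M, X) = 0] means that every map [M -> E_d] lifts  *)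
(* along [E_(d-1) -> E_d]. If this holds for [B] then it holds for a submodule   *)
(* [A]: extend [A -> E_d] to [B] by injectivity of [E_d], lift, and restrict.    *)
(* For [B] it holds by dimension shifting: [Ext^d(B, X) = Ext^k(Omega^m B, X)]   *)
(* is a direct summand of [Ext^k(Omega^(m+1) N, X) = Ext^(d+1)(N, X) = 0]. *)

(** The infimum defining [dell B] is attained at some [m <= n], and this same [m] is shown to
    qualify for [edell A]. The vanishing of Ext is carried by [cocycles_lift], which refers only to
    the fixed resolution [E] of [X]: [cocycles_lift_Omega] moves it along syzygies in both
    directions, [cocycles_lift_summand] and [cocycles_lift_prod] pass to summands up to projectives,
    [cocycles_lift_submodule] goes from [B] to [A], and [cocycles_lift_Ext_eq0] returns to
    projective resolutions. *)

Lemma inf_nat_Some (S : nat -> Prop) m : inf_nat S = Some m -> S m.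
Proof.
rewrite /inf_nat; case: pselect => // exS [<-].
by case: ex_minnP => i /asboolP.
Qed.

Lemma le_inf_natP (S : nat -> Prop) n :
  le_enat (inf_nat S) n <-> exists2 m, (m <= n)%N & S m.
Proof.
split.
  by case E: (inf_nat S) => [m|//] le_mn; exists m => //; apply: inf_nat_Some.
case=> m le_mn Sm; rewrite /inf_nat; case: pselect => [exS | []] /=.
  by case: ex_minnP => i _ min_i; apply: leq_trans le_mn; apply/min_i/asboolP.
by exists m; apply/asboolP.
Qed.

Section Modules.
Variable R : pzRingType.
Implicit Types A B I K L M N P U V X : lmodType R.

(** * Factoring, extending and lifting module maps *)

Lemma linear_exists M N (f : M -> N) :
  linear f -> exists g : {linear M -> N}, g =1 f.
Proof.
move=> lin_f; pose m := GRing.isLinear.Build R M N *:%R f lin_f.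
pose g : {linear M -> N} := HB.pack f m.
by exists g.
Qed.

Lemma exact_lin_comp0 L M N (f : {linear L -> M}) (g : {linear M -> N}) :
  exact_lin f g -> forall x, g (f x) = 0.
Proof. by move=> fg x; apply/(fg (f x)); exists x. Qed.

Section Image.
Variables (M N : lmodType R) (f : {linear M -> N}).

Definition image_pred : {pred N} := [pred y | `[< exists x, f x = y >]].

Lemma image_predP y : reflect (exists x, f x = y) (y \in image_pred).
Proof. exact: asboolP. Qed.

Fact image_submod_closed : submod_closed image_pred.
Proof.
split=> [|a _ _ /image_predP[x <-] /image_predP[y <-]]; apply/image_predP.
  by exists 0; rewrite linear0.
by exists (a *: x + y); rewrite linearP.
Qed.

HB.instance Definition _ :=
  GRing.isSubmodClosed.Build R N image_pred image_submod_closed.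

Record image_type := Image { image_val :> N; _ : image_val \in image_pred }.

HB.instance Definition _ := [isSub for image_val].
HB.instance Definition _ := [Choice of image_type by <:].
HB.instance Definition _ := [SubChoice_isSubLmodule of image_type by <:].

Lemma image_factorization :
  exists (I : lmodType R) (e : {linear M -> I}) (i : {linear I -> N}),
    [/\ surjective_lin e, injective i & forall x, i (e x) = f x].
Proof.
have im_f x : f x \in image_pred by apply/image_predP; exists x.
have [|e eE] := @linear_exists M image_type (fun x => Image (im_f x)).
  by move=> a x y; apply: val_inj; rewrite /= linearP.
exists image_type, e, (val : {linear image_type -> N}).
split=> [y | | x]; last by rewrite eE.
  have /image_predP[x fx] := valP y.
  by exists x; apply: val_inj; rewrite eE.
exact: val_inj.
Qed.

End Image.

Lemma factor_surjective P M L (p : {linear P -> M}) (h : {linear P -> L}) :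
    surjective_lin p -> (forall x, p x = 0 -> h x = 0) ->
  exists k : {linear M -> L}, forall x, k (p x) = h x.
Proof.
move=> /choice[s sK] ker_p.
have hE x y : p x = p y -> h x = h y.
  by move=> pxy; apply/subr0_eq; rewrite -linearB ker_p // linearB pxy subrr.
have [|k kE] := @linear_exists M L (h \o s); last first.
  by exists k => x; rewrite kE /= (hE _ x).
by move=> a x y /=; rewrite -linearP; apply: hE; rewrite sK linearP !sK.
Qed.

(** A map that kills the kernel of [i] descends to the image of [i], and extends from there. The map
    [i] can thus be a differential. *)
Lemma injective_module_extend I K P (i : {linear K -> P})
    (h : {linear K -> I}) :
    injective_module I -> (forall x, i x = 0 -> h x = 0) ->
  exists k : {linear P -> I}, forall x, k (i x) = h x.
Proof.
move=> injI ker_i; have [J [e [j [e_surj j_inj jeE]]]] := image_factorization i.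
have [|h' h'E] := factor_surjective (h := h) e_surj.
  by move=> x ex0; apply: ker_i; rewrite -jeE ex0 linear0.
have [k kE] := injI _ _ j h' j_inj.
by exists k => x; rewrite -jeE kE h'E.
Qed.

Lemma projective_module_lift P L M N (a : {linear L -> M}) (b : {linear M -> N})
    (h : {linear P -> M}) :
    projective_module P -> exact_lin a b -> (forall x, b (h x) = 0) ->
  exists k : {linear P -> L}, forall x, a (k x) = h x.
Proof.
move=> projP ab bh0; have [J [e [j [e_surj j_inj jeE]]]] := image_factorization a.
have im_h x : exists y, j y = h x.
  by have [y <-] := (ab _).1 (bh0 x); exists (e y).
have [s sE] := choice im_h.
have [|h' h'E] := @linear_exists P J s.
  by move=> c x y; apply: j_inj; rewrite linearP !sE linearP.
have [k kE] := projP _ _ e h' e_surj.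
by exists k => x; rewrite -jeE kE h'E sE.
Qed.

(* Dimension shifting, with the cokernel of [i] replaced by [P] and the maps   *)
(* out of it by the maps out of [P] that vanish on the image of [i]. Keeping   *)
(* [L], [M], [N] arbitrary lets [L -> M] be a differential or a coaugmentation.*)
Lemma dimension_shift K P L M N (i : {linear K -> P}) (a : {linear L -> M})
    (b : {linear M -> N}) :
    projective_module P -> injective_module M -> exact_lin a b ->
    (forall h : {linear P -> M}, (forall x, b (h (i x)) = 0) ->
      exists t : {linear P -> M},
        (forall x, t (i x) = 0) /\ (forall x, b (t x) = b (h x))) ->
  forall h : {linear K -> M},
    (forall x, i x = 0 -> h x = 0) -> (forall x, b (h x) = 0) ->
  exists t : {linear P -> L}, forall x, a (t (i x)) = h x.
Proof.
move=> projP injM ab liftP h ker_i bh0.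
have [h' h'E] := injective_module_extend injM ker_i.
have [|t [ti0 btE]] := liftP h'; first by move=> x; rewrite h'E.
(* Subtracting [t] makes the extension [h'] a cocycle without changing it on the image of [i]. *)
have [|u uE] := projective_module_lift (h := h' \- t) projP ab.
  by move=> x; rewrite /= linearB btE subrr.
by exists u => x; rewrite uE /= ti0 subr0.
Qed.

Arguments pr_projective {R M} Q i : rename.
Arguments pr_aug_surj {R M} Q : rename.
Arguments pr_exact0 {R M} Q : rename.
Arguments pr_exactS {R M} Q i : rename.
Arguments ir_injective {R X} E i : rename.
Arguments ir_coaug_inj {R X} E : rename.
Arguments ir_exact0 {R X} E : rename.
Arguments ir_exactS {R X} E i : rename.

(** * Vanishing of Ext read off an injective resolution *)

Section Lifting.
Variables (X : lmodType R) (E : injective_resolution X).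
Local Notation d := (ir_diff E).

Lemma ir_diff_diff j x : d j.+1 (d j x) = 0.
Proof. exact: (exact_lin_comp0 (ir_exactS E j) x). Qed.

(* Equivalent to [Ext^(j+1)(M, X) = 0], computed from the resolution [E].     *)
Definition cocycles_lift M j :=
  forall h : {linear M -> ir_obj E j.+1}, (forall x, d j.+1 (h x) = 0) ->
  exists t : {linear M -> ir_obj E j}, forall x, d j (t x) = h x.

Lemma cocycles_lift_summand U V j :
  direct_summand U V -> cocycles_lift V j -> cocycles_lift U j.
Proof.
move=> [W [g [g' gK g'K]]] liftV h dh0.
have lin_g' : linear g'.
  by move=> a x y; apply: (can_inj gK); rewrite linearP !g'K.
have [g'' g''E] := linear_exists lin_g'.
have lin_in : linear (fun x : U => (x, 0 : W)).
  by move=> a x y; congr pair; rewrite /= scaler0 addr0.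
have [iU iUE] := linear_exists lin_in.
have lin_fst : linear (fun x : (U * W)%type => x.1) by [].
have [pU pUE] := linear_exists lin_fst.
have [|t tE] := liftV (h \o pU \o g''); first by move=> x /=.
exists (t \o g \o iU) => x /=.
by rewrite tE /= g''E gK iUE pUE.
Qed.

Lemma cocycles_lift_prod V P j :
    projective_module P -> cocycles_lift V j -> cocycles_lift (V * P)%type j.
Proof.
move=> projP liftV h dh0.
have lin_V : linear (fun x : V => (x, 0 : P)).
  by move=> a x y; congr pair; rewrite /= scaler0 addr0.
have lin_P : linear (fun x : P => (0 : V, x)).
  by move=> a x y; congr pair; rewrite /= scaler0 addr0.
have [iV iVE] := linear_exists lin_V.
have [iP iPE] := linear_exists lin_P.
have [|t tE] := liftV (h \o iV); first by move=> x /=.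
have [|u uE] := projective_module_lift (h := h \o iP) projP (ir_exactS E j).
  by move=> x /=.
have [|s sE] := @linear_exists (V * P)%type _ (fun x => t x.1 + u x.2).
  by move=> a x y; rewrite !linearP scalerDr addrACA.
exists s => x; rewrite sE linearD tE uE /= -linearD iVE iPE.
by congr (h _); case: x => x y; congr pair; rewrite /= ?addr0 ?add0r.
Qed.

(** The complement is the zero module ['rV[R]_0]. *)
Lemma isomorphic_direct_summand U V : isomorphic U V -> direct_summand U V.
Proof.
move=> [g [g' gK g'K]].
have [|k kE] := @linear_exists (U * 'rV[R]_0)%type V (fun x => g x.1).
  by move=> a x y; rewrite -linearP.
exists 'rV[R]_0, k; exists (fun y => (g' y, 0)) => [[x y] | y]; rewrite kE /=.
  by rewrite gK [y]thinmx0.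
by rewrite g'K.
Qed.

Lemma isomorphic_sym U V : isomorphic U V -> isomorphic V U.
Proof.
move=> [g [g' gK g'K]].
have [|k kE] := @linear_exists V U g'.
  by move=> a x y; apply: (can_inj gK); rewrite linearP !g'K.
by exists k; exists g => x; rewrite kE ?gK ?g'K.
Qed.

Lemma cocycles_lift_syzygy M K j :
  is_syzygy M K -> cocycles_lift M j.+1 -> cocycles_lift K j.
Proof.
move=> [P [p [i [[projP p_surj _] i_inj ip]]]] liftM h dh0.
have pi0 := exact_lin_comp0 ip.
have [|| //|t tE] := @dimension_shift _ _ _ _ _ i (d j) (d j.+1) projP
  (ir_injective E j.+1) (ir_exactS E j) _ h; last 2 first.
- by move=> x; rewrite -(linear0 i) => /i_inj->; rewrite linear0.
- by exists (t \o i).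
move=> h' dh'i0.
have [x px0|k kE] := factor_surjective (h := d j.+1 \o h') p_surj.
  by have [y <-] := (ip x).1 px0; apply: dh'i0.
have [x|t tE] := liftM k.
  by have [y <-] := p_surj x; rewrite kE /= ir_diff_diff.
by exists (t \o p); split=> x /=; rewrite ?pi0 ?linear0 // tE kE.
Qed.

(** Lift [h \o p] to [h'] on [P]. Its restriction to [K] is a cocycle, hence a coboundary [d t];
    extending [t] to [P] and subtracting its coboundary makes [h'] vanish on [K], so that it
    descends to [M]. *)
Lemma syzygy_cocycles_lift M K j :
  is_syzygy M K -> cocycles_lift K j -> cocycles_lift M j.+1.
Proof.
move=> [P [p [i [[projP p_surj _] i_inj ip]]]] liftK h dh0.
have pi0 := exact_lin_comp0 ip.
have [|h' h'E] :=
    projective_module_lift (h := h \o p) projP (ir_exactS E j.+1).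
  by move=> x /=.
have [x|t tE] := liftK (h' \o i); first by rewrite /= h'E /= pi0 linear0.
have [t' t'E] := ir_injective E j _ _ i t i_inj.
have [x px0|k kE] := factor_surjective (h := h' \- (d j \o t')) p_surj.
  by have [y <-] := (ip x).1 px0; rewrite /= t'E tE subrr.
exists k => x; have [y <-] := p_surj x.
by rewrite kE /= linearB h'E ir_diff_diff subr0.
Qed.

Lemma cocycles_lift_Omega m M K j : is_Omega m M K ->
  cocycles_lift M (j + m) <-> cocycles_lift K j.
Proof.
elim: m K j => [|m IHm] K j /=.
  rewrite addn0 => isoMK; split; apply: cocycles_lift_summand;
    apply: isomorphic_direct_summand => //; exact: isomorphic_sym.
move=> [L [/IHm IH syz]]; rewrite addnS -addSn IH.
by split; [apply: cocycles_lift_syzygy | apply: syzygy_cocycles_lift].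
Qed.

Lemma cocycles_lift_submodule A B (f : {linear A -> B}) j :
    injective f -> (forall x : ir_obj E j.+2, x = 0) ->
  cocycles_lift B j -> cocycles_lift A j.
Proof.
move=> f_inj E0 liftB h _; have [h' h'E] := ir_injective E j.+1 _ _ f h f_inj.
(* The extension [h'] is a cocycle only because the next term of [E] is zero. *)
have [x|t tE] := liftB h'; first exact: E0.
by exists (t \o f) => x; rewrite /= tE h'E.
Qed.

(** A walk through the double complex of maps from [Q_i] to [E_j'] along [i + j' = j], from the
    augmentation of [Q] to the coaugmentation of [E]. *)
Lemma cocycles_lift_Ext_eq0 M j : cocycles_lift M j -> Ext_eq0 j.+1 M X.
Proof.
move=> liftM Q.
pose del := pr_diff Q.
have dd0 i := exact_lin_comp0 (pr_exactS Q i).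
(* Modulo maps into the kernel of [d j'], [h] can be replaced by a map vanishing on the image of
   [del i]: the hypothesis of [dimension_shift] one step further. *)
have liftQ i j' : (i + j' = j)%N -> forall h : {linear pr_obj Q i -> ir_obj E j'},
    (forall x, d j' (h (del i x)) = 0) ->
    exists t : {linear pr_obj Q i -> ir_obj E j'},
      (forall x, t (del i x) = 0) /\ (forall x, d j' (t x) = d j' (h x)).
  elim: i j' => [|i IHi] j'.
    rewrite add0n => -> h dh0.
    have [x px0|k kE] :=
        factor_surjective (h := d j \o h) (pr_aug_surj Q).
      by have [y <-] := (pr_exact0 Q x).1 px0; apply: dh0.
    have [x|t tE] := liftM k.
      by have [y <-] := pr_aug_surj Q x; rewrite kE /= ir_diff_diff.
    exists (t \o pr_aug Q); split=> x /=; last by rewrite tE kE.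
    by rewrite (exact_lin_comp0 (pr_exact0 Q)) linear0.
  rewrite addSnnS => /IHi liftQ h dh0.
  have [x|x|t tE] := dimension_shift (pr_projective Q i) (ir_injective E j'.+1)
    (ir_exactS E j') liftQ (h := d j' \o h).
  - by case/(pr_exactS Q i x) => y <-; apply: dh0.
  - exact: ir_diff_diff.
  exists (t \o del i); split=> x /=; last by rewrite tE.
  by rewrite dd0 linear0.
move=> g g_cocycle.
have [x|x|t tE] := dimension_shift (pr_projective Q j) (ir_injective E 0)
  (ir_exact0 E) (liftQ j 0%N (addn0 j)) (h := ir_coaug E \o g).
- by case/(pr_exactS Q j x) => y <- /=; rewrite g_cocycle linear0.
- exact: (exact_lin_comp0 (ir_exact0 E) (g x)).
by exists t => x; apply: (ir_coaug_inj E); rewrite tE.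
Qed.

End Lifting.

Lemma edell_le_of_dell_le A B (f : {linear A -> B}) n :
  injective f -> le_enat (dell B) n -> le_enat (edell A) n.
Proof.
move=> f_inj /le_inf_natP[m le_mn [N [U [V [_ BU NV [P [projP UVP]]]]]]].
apply/le_inf_natP; exists m => // -[//|k] X _.
rewrite addnS addnC => /inf_nat_Some[E E0].
apply: (cocycles_lift_Ext_eq0 (E := E)).
apply: (cocycles_lift_submodule f_inj); first exact/E0.
apply/(cocycles_lift_Omega E k BU).
apply: cocycles_lift_summand UVP _; apply: cocycles_lift_prod => //.
(* On [N] the index has become [k + m.+1], so the maps to lift land in a zero term of [E], beyond
   the injective dimension. *)
apply/(cocycles_lift_Omega E k NV) => h _.
exists \0 => x; rewrite linear0; apply/esym/E0.
by rewrite addnS.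
Qed.

End Modules.

(* Right modules over Lambda are left modules over the converse ring Lambda^c. *)
Theorem lemma2p20 (F : fieldType) (Lambda : falgType F)
    (A B : lmodType Lambda^c) (f : {linear A -> B}) (n : nat) :
  injective f -> le_enat (dell B) n -> le_enat (edell A) n.
Proof. exact: edell_le_of_dell_le. Qed.
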